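(* Let $T>0$. Let $h:(0,\infty)\to(0,\infty)$ be a bounded function with $\lim_{u\to0^+}h(u)=\lim_{u\to+\infty}h(u)=0$, and let $A\in C^1([0,T]\times(0,1)^n;\mathbb S(n))$ satisfy $$|A_{ij}(s,\mu)|\le(\mu^i+\mu^j)\,h(\mu^j/\mu^i)\qquad\text{for all }(i,j)\in\mathbb E,\ (s,\mu)\in[0,T]\times(0,1)^n.$$ Then, for every $\epsilon>0$ and every $\mu\in\mathcal P_\epsilon(\mathbb G)$, the equation $$\dot\rho(s)=\nabla_{\mathbb G}\cdot A(s,\rho(s))+\Delta_{\mathbb G}\rho(s),\qquad \rho(0)=\mu,$$ admits a unique classical solution $\rho\in C^1([0,T];(0,1)^n)$, and there exist constants $c,r>0$ depending only on $n$, $\omega_{\min}$, $\omega_{\max}$ and $h$ such that $$\min_{1\le i\le n}\rho_i(s)\ge c\,\epsilon\,e^{-rs}\qquad\text{for all } s\in[0,T].$$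
   Context: $\mathbb G=(\mathbb V,\mathbb E,\omega)$ is a finite, connected, simple undirected graph with vertex set $\mathbb V=\{1,\dots,n\}$, edge set $\mathbb E$ (viewed as ordered pairs with $(i,j)\in\mathbb E\iff(j,i)\in\mathbb E$, no self-loops), and $\omega=(\omega_{ij})$ a symmetric $n\times n$ matrix with nonnegative entries such that $\omega_{ij}>0$ iff $(i,j)\in\mathbb E$; $\omega_{\min}=\min_{(i,j)\in\mathbb E}\omega_{ij}$, $\omega_{\max}=\max_{(i,j)\in\mathbb E}\omega_{ij}$. $\mathbb S(n)$ is the space of real skew-symmetric $n\times n$ matrices. For $m\in\mathbb S(n)$, $\nabla_{\mathbb G}\cdot m\in\mathbb R^n$ has components $(\nabla_{\mathbb G}\cdot m)^i=\sum_{j\ne i}\sqrt{\omega_{ij}}\,m^{ji}$; for $u\in\mathbb R^n$, $\nabla_{\mathbb G}u\in\mathbb S(n)$ has entries $(\nabla_{\mathbb G}u)^{ij}=\sqrt{\omega_{ij}}(u^i-u^j)$, and $\Delta_{\mathbb G}u:=\nabla_{\mathbb G}\cdot\nabla_{\mathbb G}u$, i.e. $(\Delta_{\mathbb G}u)^i=\sum_j\omega_{ij}(u^j-u^i)$. Components of a vector $\rho$ are written $\rho_i$ or $\rho^i$. $\mathcal P(\mathbb G)$ is the probability simplex in $\mathbb R^n$ and $\mathcal P_\epsilon(\mathbb G)=\{\mu\in\mathcal P(\mathbb G):\mu^i>\epsilon\ \forall i\}$. *)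

(* Defs.v *)
From HB Require Import structures.
From mathcomp Require Import all_boot all_order all_algebra.
From mathcomp Require Import all_classical all_reals all_analysis.
Set Implicit Arguments.
Unset Strict Implicit.
Unset Printing Implicit Defensive.
Import Order.TTheory GRing.Theory Num.Theory.
Local Open Scope ring_scope.

Section GraphODE.
Variable R : realType.
Variable n : nat.

(* A finite, connected, simple undirected weighted graph on vertices 'I_n,
   given by its symmetric nonnegative weight matrix with zero diagonal;
   (i,j) is an edge iff 0 < w i j. *)
Definition weighted_graph (w : 'M[R]_n) : Prop :=
  (forall i j, w i j = w j i) /\
  (forall i j, 0 <= w i j) /\
  (forall i, w i i = 0) /\
  (forall i j, connect (fun a b : 'I_n => 0 < w a b) i j).

Definition is_omega_min (w : 'M[R]_n) (m : R) : Prop :=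
  (exists i j, 0 < w i j /\ w i j = m) /\
  (forall i j, 0 < w i j -> m <= w i j).

Definition is_omega_max (w : 'M[R]_n) (m : R) : Prop :=
  (exists i j, 0 < w i j /\ w i j = m) /\
  (forall i j, 0 < w i j -> w i j <= m).

Definition skewG (m : 'M[R]_n) : Prop := m^T = - m.

Definition divG (w : 'M[R]_n) (m : 'M[R]_n) : 'I_n -> R :=
  fun i => \sum_(j < n | j != i) Num.sqrt (w i j) * m j i.

Definition lapG (w : 'M[R]_n) (u : 'I_n -> R) : 'I_n -> R :=
  fun i => \sum_(j < n) w i j * (u j - u i).

Definition P_eps (eps : R) (mu : 'I_n -> R) : Prop :=
  (forall i, 0 <= mu i) /\ (\sum_(i < n) mu i = 1) /\ (forall i, eps < mu i).

Definition in_dom (T s : R) (mu : 'I_n -> R) : Prop :=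
  0 <= s <= T /\ (forall k, 0 < mu k < 1).

(* A in C^1([0,T] x (0,1)^n ; R^{n x n}): differentiable (within the domain)
   with partial derivatives dAs (in s) and dAm k (in mu_k) continuous on the
   domain. *)
Definition C1_dom (T : R) (A : R -> ('I_n -> R) -> 'M[R]_n) : Prop :=
  exists (dAs : R -> ('I_n -> R) -> 'M[R]_n)
         (dAm : R -> ('I_n -> R) -> 'I_n -> 'M[R]_n),
  (forall s mu, in_dom T s mu -> forall e, 0 < e -> exists d, 0 < d /\
     forall t nu, in_dom T t nu -> `|t - s| < d -> (forall k, `|nu k - mu k| < d) ->
     forall i j,
       `|A t nu i j - A s mu i j - (t - s) * dAs s mu i j
          - \sum_(k < n) (nu k - mu k) * dAm s mu k i j|
       <= e * (`|t - s| + \sum_(k < n) `|nu k - mu k|)) /\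
  (forall s mu, in_dom T s mu -> forall e, 0 < e -> exists d, 0 < d /\
     forall t nu, in_dom T t nu -> `|t - s| < d -> (forall k, `|nu k - mu k| < d) ->
     forall i j, `|dAs t nu i j - dAs s mu i j| < e /\
                 (forall k, `|dAm t nu k i j - dAm s mu k i j| < e)).

(* f' is the derivative of f on [0,T] (one-sided at the endpoints) *)
Definition deriv_cc (T : R) (f f' : R -> R) : Prop :=
  forall s, 0 <= s <= T -> forall e, 0 < e -> exists d, 0 < d /\
    forall t, 0 <= t <= T -> `|t - s| < d ->
      `|f t - f s - (t - s) * f' s| <= e * `|t - s|.

Definition cont_cc (T : R) (g : R -> R) : Prop :=
  forall s, 0 <= s <= T -> forall e, 0 < e -> exists d, 0 < d /\
    forall t, 0 <= t <= T -> `|t - s| < d -> `|g t - g s| < e.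

Definition ode_sol (w : 'M[R]_n) (A : R -> ('I_n -> R) -> 'M[R]_n)
    (T : R) (mu : 'I_n -> R) (rho : R -> 'I_n -> R) : Prop :=
  (forall i, rho 0 i = mu i) /\
  (forall s, 0 <= s <= T -> forall i, 0 < rho s i < 1) /\
  exists rho' : R -> 'I_n -> R,
    (forall i, deriv_cc T (fun s => rho s i) (fun s => rho' s i) /\
               cont_cc T (fun s => rho' s i)) /\
    (forall s, 0 <= s <= T -> forall i,
        rho' s i = divG w (A s (rho s)) i + lapG w (rho s) i).

End GraphODE.

(* Main.v *)
Require Import Defs.
From HB Require Import structures.
From mathcomp Require Import all_boot all_order all_algebra.
From mathcomp Require Import all_classical all_reals all_analysis.
From mathcomp Require Import ring lra.
Set Implicit Arguments.
Unset Strict Implicit.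
Unset Printing Implicit Defensive.
Import Order.TTheory GRing.Theory Num.Theory.
Import numFieldNormedType.Exports.
Local Open Scope ring_scope.
Local Open Scope classical_set_scope.

(** Edge by edge the drift satisfies [rho_i' >= - r rho_i]: where
    [rho_j / rho_i] is large, [h] is so small that the diffusive inflow absorbs
    the transport term, and elsewhere both terms are [O(rho_i)]. This gives the
    lower bound with [c = 1]. Since the total mass is conserved, a solution
    stays in the cube [[a, 1 - a]^n] with [a = eps e^(-rT)], and so does every
    solution of the equation truncated to that cube. The truncated field is
    globally Lipschitz, so existence and uniqueness on all of [[0, T]] follow
    from Picard iteration in the norm weighted by [e^(-2Ls)]. *)

(** * Calculus on [[0, T]]: clamping, derivatives, monotonicity, antiderivatives *)

Section Calculus.
Variable R : realType.
Implicit Types (T a b c s t x : R) (f g : R -> R).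

Definition clamp a b x := Num.max a (Num.min x b).

Lemma clamp_itv a b x : a <= b -> a <= clamp a b x <= b.
Proof. by move=> ab; rewrite /clamp le_max lexx ge_max ab ge_min lexx orbT. Qed.

Lemma clamp_id a b x : a <= x <= b -> clamp a b x = x.
Proof. by move=> /andP[ax xb]; rewrite /clamp min_l // max_r. Qed.

Lemma clamp_le_max a b x : clamp a b x <= Num.max a x.
Proof. by rewrite /clamp ge_max !le_max lexx /= !ge_min lexx !orbT. Qed.

Lemma clamp_dist a b x y : `|clamp a b x - clamp a b y| <= `|x - y|.
Proof.
have := ler_norm (x - y); have := ler_norm (y - x); rewrite (distrC y x).
rewrite /clamp ler_norml.
by case: (leP x b) => ?; case: (leP y b) => ?; case: (leP a x) => ?;
  case: (leP a y) => ?; case: (leP a b) => ?; lra.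
Qed.

(** This direction gives access to the mean value theorem, the converse below to the fundamental
    theorem of calculus. *)
Lemma deriv_at_is_derive f x d :
  (forall e : R, 0 < e -> exists2 dl, 0 < dl & forall t, `|t - x| < dl ->
     `|f t - f x - (t - x) * d| <= e * `|t - x|) -> is_derive x 1 f d.
Proof.
move=> H.
have cv : h^-1 *: ((f \o shift x) (h *: 1) - f x) @[h --> 0^'] --> d.
  apply/cvgrPdist_le => e e0; have [dl dl0 Hd] := H _ e0.
  near=> k.
  have k0 : k != 0 by near: k; exact: nbhs_dnbhs_neq.
  have kd : `|k| < dl by near: k; apply: dnbhs0_lt.
  have := Hd (k + x); rewrite addrK => /(_ kd).
  rewrite /= /GRing.scale /= mulr1 => Hk.
  have -> : d - k^-1 * (f (k + x) - f x) =
            - (k^-1 * (f (k + x) - f x - k * d)) by field.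
  rewrite normrN normrM normfV mulrC ler_pdivrMr ?normr_gt0 //.
split; first by apply/cvg_ex; exists d.
by apply/cvg_lim.
Unshelve. all: by end_near. Qed.

Lemma is_derive_deriv_at f x d : is_derive x 1 f d ->
  forall e : R, 0 < e -> exists2 dl, 0 < dl & forall t, `|t - x| < dl ->
     `|f t - f x - (t - x) * d| <= e * `|t - x|.
Proof.
move=> [df dE] e e0.
have : h^-1 *: ((f \o shift x) (h *: 1) - f x) @[h --> 0^'] --> d.
  by rewrite -dE; exact: df.
move/cvgrPdist_le => /(_ _ e0); rewrite near_withinE.
move/nbhs_ballP => [dl /= dl0 Hd]; exists dl => // t tx.
have [->|tx0] := eqVneq t x; first by rewrite !subrr mul0r subr0 normr0 mulr0.
have := Hd (t - x); rewrite -ball_normE /ball_ /= sub0r normrN subr_eq0 => /(_ tx tx0).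
rewrite /GRing.scale /= mulr1 subrK => Hk.
have tx0' : t - x != 0 by rewrite subr_eq0.
have -> : f t - f x - (t - x) * d =
   - ((d - (t - x)^-1 * (f t - f x)) * (t - x)) by field.
by rewrite normrN normrM ler_wpM2r.
Qed.

Lemma is_derive_deriv_cc T f f' :
  (forall s, 0 <= s <= T -> is_derive s 1 f (f' s)) -> deriv_cc T f f'.
Proof.
move=> H s sT e e0.
have [dl dl0 Hd] := is_derive_deriv_at (H _ sT) e0.
by exists dl; split => // t _; exact: Hd.
Qed.

Lemma deriv_cc_cont T f f' : deriv_cc T f f' -> cont_cc T f.
Proof.
move=> H s sT e e0; have [d [d0 Hd]] := H s sT 1 ltr01.
have p0 : 0 < `|f' s| + 1 by rewrite ltr_wpDl.
exists (Num.min d (e / (`|f' s| + 1))); split.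
  by rewrite lt_min d0 divr_gt0.
move=> t tT; rewrite lt_min => /andP[td te].
have := Hd t tT td; rewrite mul1r => H1.
have : `|f t - f s| <= `|t - s| * `|f' s| + `|t - s|.
  rewrite -normrM -[f t - f s](subrK ((t - s) * f' s)).
  by rewrite (le_trans (ler_normD _ _)) // addrC lerD2l.
move/le_lt_trans; apply; rewrite ltr_pdivlMr // in te.
by rewrite mulrDr mulr1 in te.
Qed.

Lemma deriv_ccD T f f' g g' : deriv_cc T f f' -> deriv_cc T g g' ->
  deriv_cc T (fun s => f s + g s) (fun s => f' s + g' s).
Proof.
move=> Hf Hg s sT e e0; have e2 : 0 < e / 2 by rewrite divr_gt0.
have [d [d0 Hd]] := Hf s sT _ e2; have [k [k0 Hk]] := Hg s sT _ e2.
exists (Num.min d k); split; first by rewrite lt_min d0 k0.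
move=> t tT; rewrite lt_min => /andP[td tk].
have := Hd t tT td; have := Hk t tT tk.
set a := (X in `|X| <= _ -> _); set b := (X in _ -> `|X| <= _ -> _) => Ha Hb.
have -> : f t + g t - (f s + g s) - (t - s) * (f' s + g' s) = a + b.
  by rewrite /a /b; ring.
by rewrite (le_trans (ler_normD _ _)) //; lra.
Qed.

Lemma deriv_ccZ T c f f' : deriv_cc T f f' ->
  deriv_cc T (fun s => c * f s) (fun s => c * f' s).
Proof.
move=> Hf s sT e e0.
have c0 : 0 < `|c| + 1 by rewrite ltr_wpDl.
have [d [d0 Hd]] := Hf s sT _ (divr_gt0 e0 c0).
exists d; split => // t tT td.
have -> : c * f t - c * f s - (t - s) * (c * f' s) =
          c * (f t - f s - (t - s) * f' s) by ring.
rewrite normrM (le_trans (ler_wpM2l (normr_ge0 c) (Hd t tT td))) //.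
rewrite mulrA ler_wpM2r // mulrA ler_pdivrMr //; lra.
Qed.

Lemma deriv_ccB T f f' g g' : deriv_cc T f f' -> deriv_cc T g g' ->
  deriv_cc T (fun s => f s - g s) (fun s => f' s - g' s).
Proof.
move=> Hf /(@deriv_ccZ T (-1)) Hg; have := deriv_ccD Hf Hg.
by congr deriv_cc; apply/funext => s; rewrite mulN1r.
Qed.

Lemma deriv_cc_cst T c : deriv_cc T (fun=> c) (fun=> 0).
Proof. by apply: is_derive_deriv_cc => s _; exact: is_derive_cst. Qed.

Lemma deriv_cc_sum T n (f f' : 'I_n -> R -> R) :
  (forall i, deriv_cc T (f i) (f' i)) ->
  deriv_cc T (fun s => \sum_i f i s) (fun s => \sum_i f' i s).
Proof.
move=> H; rewrite /index_enum; elim: (Finite.enum _) => [|i r IH].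
  have := @deriv_cc_cst T 0; congr deriv_cc; by apply/funext => s; rewrite big_nil.
have := deriv_ccD (H i) IH.
by congr deriv_cc; apply/funext => s; rewrite big_cons.
Qed.

Lemma deriv_cc_expR T c k :
  deriv_cc T (fun s => c * expR (k * s)) (fun s => c * (k * expR (k * s))).
Proof.
apply: deriv_ccZ; apply: is_derive_deriv_cc => s _.
rewrite mulrC; apply: (@is_derive1_comp R expR (fun s => k * s)).
apply: deriv_at_is_derive => e e0; exists 1 => // t _.
have -> : k * t - k * s - (t - s) * k = 0 by ring.
by rewrite normr0 mulr_ge0 // ltW.
Qed.

Lemma deriv_cc_ge0_le T f f' a b : deriv_cc T f f' ->
  0 <= a -> a <= b -> b <= T -> (forall s, a < s < b -> 0 <= f' s) ->
  f a <= f b.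
Proof.
move=> H a0 ab bT Hp.
have [<-|ab'] := eqVneq a b; first by [].
have {}ab : a < b by rewrite lt_neqAle ab' ab.
have [||c] := @MVT R f f' a b ab.
- move=> x; rewrite in_itv /= => /andP[ax xb].
  apply: deriv_at_is_derive => e e0.
  have xT : 0 <= x <= T by lra.
  have [d [d0 Hd]] := H x xT e e0.
  (* [is_derive] is two-sided, so the radius also keeps [t] between [a] and [b], where [deriv_cc]
     applies. *)
  exists (Num.min d (Num.min (x - a) (b - x))).
    by rewrite !lt_min d0 !subr_gt0 ax xb.
  move=> t; rewrite !lt_min => /and3P[td /ltr_normlP [t1 t2] /ltr_normlP[t3 t4]].
  by apply: Hd => //; lra.
- apply/subspace_continuousP => x /=; rewrite in_itv /= => /andP[ax xb].
  apply/cvgrPdist_lt => e e0.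
  have xT : 0 <= x <= T by lra.
  have [d [d0 Hd]] := deriv_cc_cont H xT e0.
  rewrite near_withinE; apply/nbhs_ballP; exists d => //= t.
  rewrite -ball_normE /ball_ /= distrC => td; rewrite in_itv /= => /andP[at_ tb].
  by rewrite distrC; apply: Hd => //; lra.
rewrite in_itv /= => cab fE; rewrite -subr_ge0 fE mulr_ge0 ?Hp //; lra.
Qed.

(** Both [g - f] and [g + f] are nondecreasing. This plays the part of bounding an integral by that
    of a majorant. *)
Lemma deriv_cc_dist_le T f f' g g' t : deriv_cc T f f' -> deriv_cc T g g' ->
  0 <= t <= T -> (forall s, 0 <= s <= T -> `|f' s| <= g' s) ->
  `|f t - f 0| <= g t - g 0.
Proof.
move=> Hf Hg /andP[t0 tT] H.
have hs s : 0 < s < t -> - g' s <= f' s /\ f' s <= g' s.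
  by move=> st; have := H s; rewrite ler_norml => /(_ _)/andP; apply; lra.
have /= H1 := deriv_cc_ge0_le (deriv_ccB Hg Hf) (lexx 0) t0 tT.
have /= H2 := deriv_cc_ge0_le (deriv_ccD Hg Hf) (lexx 0) t0 tT.
have {}H1 : g 0 - f 0 <= g t - f t by apply: H1 => s /hs []; lra.
have {}H2 : g 0 + f 0 <= g t + f t by apply: H2 => s /hs []; lra.
rewrite ler_norml; lra.
Qed.

Lemma deriv_cc_linear T c : deriv_cc T (fun s => c * s) (fun=> c).
Proof.
move=> s _ e e0; exists 1; split => // t _ _.
by rewrite -mulrBr mulrC subrr normr0 mulr_ge0 // ltW.
Qed.

(** Barrier principle: past the last time [z] with [f z >= 0], [f] is negative, hence nondecreasing,
    so it cannot have dropped below [f z]. The sign of [f'] is asked for only below the barrier. *)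
Lemma deriv_cc_ge0 T f f' : deriv_cc T f f' -> 0 <= f 0 ->
  (forall s, 0 <= s <= T -> f s < 0 -> 0 <= f' s) ->
  forall t, 0 <= t <= T -> 0 <= f t.
Proof.
move=> df f0 H t /andP[t0 tT]; rewrite leNgt; apply/negP => ft.
pose S := [set x | 0 <= x <= t /\ 0 <= f x].
have hS : has_sup S.
  split; first by exists 0; rewrite /S /= lexx t0.
  by exists t => x [/andP[]].
set z := sup S.
have z0 : 0 <= z by apply: sup_upper_bound => //; rewrite /S /= lexx t0.
have zt : z <= t by apply: ge_sup; [exact: hS.1|move=> x [/andP[]]].
have fz : 0 <= f z.
  rewrite leNgt; apply/negP => fz.
  have zT : 0 <= z <= T by rewrite z0 (le_trans zt tT).
  have e0 : 0 < - f z by rewrite oppr_gt0.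
  have [d [d0 Hd]] := deriv_cc_cont df zT e0.
  have [x [/andP[x0 xt] fx] zx] := sup_adherent d0 hS.
  have xz : x <= z by apply: sup_upper_bound => //; split => //; rewrite x0.
  have := Hd x; rewrite ler0_norm; last by lra.
  move=> /(_ _ _)/ltr_normlP[]; [lra|rewrite -/z in zx; lra|lra].
have : f z <= f t; last by lra.
apply: (deriv_cc_ge0_le df) => // s /andP[zs st].
apply: H; first by lra.
rewrite ltNge; apply/negP => fs.
have : s <= z by apply: sup_upper_bound => //; split => //; lra.
lra.
Qed.

(** [g] is extended by constants and integrated from [-1], so that [0] and [T] are interior to
    [[-1, T + 1]] and the fundamental theorem covers them too. *)
Lemma cont_cc_antiderivative T g : 0 <= T -> cont_cc T g ->
  exists2 G : R -> R, G 0 = 0 & deriv_cc T G g.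
Proof.
move=> T0 cg; pose f s := g (clamp 0 T s).
have cf : continuous f.
  move=> x; apply/cvgrPdist_lt => e e0.
  have [d [d0 Hd]] := cg _ (clamp_itv x T0) _ e0.
  apply/nbhs_ballP; exists d => //= t xt.
  have {xt}td : `|t - x| < d by rewrite distrC; exact: xt.
  by rewrite distrC; apply: Hd; [exact: clamp_itv|apply: le_lt_trans td; exact: clamp_dist].
have If : lebesgue_measure.-integrable `[-1, T + 1] (EFin \o f).
  apply: continuous_compact_integrable; first exact: segment_compact.
  by apply: continuous_subspaceT.
pose F x := \int[lebesgue_measure]_(t in `[(-1 : R), x]) f t.
exists (fun x => F x - F 0); first by rewrite subrr.
have : deriv_cc T (fun x => F x - F 0) (fun s => g s - 0).
  apply: deriv_ccB; last exact: deriv_cc_cst.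
  apply: is_derive_deriv_cc => s sT.
  have sT1 : s < T + 1 by lra.
  have s1 : -1 < s by lra.
  have [dF FE] := continuous_FTC1_closed sT1 If s1 (cf s).
  split; first exact: dF.
  by rewrite -derive1E FE /f clamp_id.
by congr deriv_cc; apply/funext => s; rewrite subr0.
Qed.

(** With [q k] the tail of the geometric series, the intervals [[u k - q k, u k + q k]] are nested;
    the limit is the supremum of their left endpoints. *)
Lemma geometric_cauchy (u : nat -> R) D :
  (forall k, `|u k.+1 - u k| <= D / 2 ^+ k) ->
  exists l, forall k, `|l - u k| <= 2 * D / 2 ^+ k.
Proof.
move=> H.
pose q k : R := 2 * D / 2 ^+ k.
have qS k : q k = q k.+1 + D / 2 ^+ k.
  by rewrite /q exprS; field; rewrite expf_neq0.
have D0 : 0 <= D by have := H 0%N; rewrite expr0 divr1; apply: le_trans.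
have q0 k : 0 <= q k by rewrite /q divr_ge0 ?mulr_ge0 // exprn_ge0.
have up m k : u k - q k <= u (k + m)%N - q (k + m)%N.
  elim: m => [|m IH]; first by rewrite addn0.
  apply: (le_trans IH); rewrite addnS.
  by have := H (k + m)%N; rewrite ler_norml => /andP[]; have := qS (k + m)%N; lra.
have dn m k : u (k + m)%N + q (k + m)%N <= u k + q k.
  elim: m => [|m IH]; first by rewrite addn0.
  apply: (le_trans _ IH); rewrite addnS.
  by have := H (k + m)%N; rewrite ler_norml => /andP[]; have := qS (k + m)%N; lra.
pose E := [set u k - q k | k in @setT nat].
have ubE k : ubound E (u k + q k).
  move=> _ [m _ <-]; have := up k m; have := dn m k; rewrite addnC.
  have := q0 (m + k)%N; lra.
have nE : E !=set0 by exists (u 0%N - q 0%N), 0%N.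
exists (sup E) => k; rewrite -/(q k) ler_norml.
have h1 : u k - q k <= sup E.
  by apply: sup_upper_bound; [split => //; exists (u 0%N + q 0%N)|exists k].
have h2 : sup E <= u k + q k by apply: ge_sup.
lra.
Qed.

End Calculus.

(** * Picard iteration for a bounded, globally Lipschitz field *)

Section Picard.
Variable R : realType.

Lemma exists_div_exp2_lt (C e : R) : 0 < e -> exists k, C / 2 ^+ k < e.
Proof.
move=> e0; exists (Num.bound `|C / e|).
have p0 k : (0 : R) < 2 ^+ k by rewrite exprn_gt0.
rewrite ltr_pdivrMr // mulrC -ltr_pdivrMr //.
apply: (le_lt_trans (ler_norm _)); apply: (lt_trans (archi_boundP (normr_ge0 _))).
by rewrite -natrX ltr_nat ltn_expl.
Qed.

Lemma le0_of_le_div_exp2 (x C : R) : (forall k, x <= C / 2 ^+ k) -> x <= 0.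
Proof.
move=> H; rewrite leNgt; apply/negP => /(exists_div_exp2_lt C) [k].
by rewrite ltNge H.
Qed.

Lemma common_radius n (P : 'I_n -> R -> Prop) :
  (forall k d d', d' <= d -> P k d -> P k d') ->
  (forall k, exists2 d, 0 < d & P k d) -> exists2 d, 0 < d & forall k, P k d.
Proof.
move=> mon ex.
have /choice[f Hf] k : exists d, 0 < d /\ P k d.
  by have [d d0 Pd] := ex k; exists d.
exists (\big[Num.min/1]_k f k).
  by apply/bigmin_gtP; split => // k _; have [] := Hf k.
by move=> k; apply: (mon k (f k)); [exact: bigmin_le|have [] := Hf k].
Qed.

Variables (n : nat) (T : R) (G : R -> ('I_n -> R) -> 'I_n -> R) (L B : R).
Hypothesis T0 : 0 <= T.
Hypothesis L0 : 0 < L.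
Hypothesis G_lip : forall s x y D, 0 <= s <= T ->
  (forall k, `|x k - y k| <= D) -> forall i, `|G s x i - G s y i| <= L * D.
Hypothesis G_cont : forall x i, cont_cc T (fun s => G s x i).
Hypothesis G_bound : forall s x i, 0 <= s <= T -> `|G s x i| <= B.

(** The increment splits into a change of state at fixed time, controlled by [L], and a change of
    time at the fixed state [u s]. *)
Lemma cont_cc_field_comp (u : R -> 'I_n -> R) :
  (forall i, cont_cc T (u^~ i)) -> forall i, cont_cc T (fun s => G s (u s) i).
Proof.
move=> cu i s sT e e0.
have e1 : 0 < e / 2 / L by rewrite !divr_gt0.
have [d1 d10 H1] : exists2 d, 0 < d & forall k t, 0 <= t <= T -> `|t - s| < d ->
    `|u t k - u s k| < e / 2 / L.
  apply: common_radius => [k d d' dd' H t tT td|k].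
    by apply: H => //; exact: lt_le_trans dd'.
  by have [d [d0 H]] := cu k s sT _ e1; exists d.
have e2 : 0 < e / 2 by rewrite divr_gt0.
have [d2 [d20 H2]] := G_cont (u s) i sT e2.
exists (Num.min d1 d2); split; first by rewrite lt_min d10 d20.
move=> t tT; rewrite lt_min => /andP[t1 t2].
have h2 := H2 t tT t2.
have h1 : `|G t (u t) i - G t (u s) i| <= L * (e / 2 / L).
  by apply: G_lip => // k; apply/ltW/H1.
have : L * (e / 2 / L) = e / 2 by field; rewrite gt_eqF.
have := ler_distD (G t (u s) i) (G t (u t) i) (G s (u s) i); lra.
Qed.

(* With the weight [expR (2 L s)] the Picard operator halves distances on the
   whole of [0, T], so no continuation argument is needed. *)
Lemma picard_halves (u v U V : R -> 'I_n -> R) D :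
  (forall i, deriv_cc T (U^~ i) (fun s => G s (u s) i)) ->
  (forall i, deriv_cc T (V^~ i) (fun s => G s (v s) i)) ->
  (forall i, U 0 i = V 0 i) -> 0 <= D ->
  (forall s i, 0 <= s <= T -> `|u s i - v s i| <= D * expR (2 * L * s)) ->
  forall s i, 0 <= s <= T -> `|U s i - V s i| <= D / 2 * expR (2 * L * s).
Proof.
move=> HU HV UV D0 H s i sT.
have := deriv_cc_dist_le (deriv_ccB (HU i) (HV i))
  (@deriv_cc_expR _ T (D / 2) (2 * L)) sT.
rewrite UV subrr subr0 mulr0 expR0 mulr1 => /(_ _)/le_trans; apply; last first.
  by rewrite gerBl divr_ge0.
move=> x xT.
(* The slope of the majorant is exactly the Lipschitz bound on the difference of the fields; this
   fixes the [2] in the weight. *)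
have -> : D / 2 * (2 * L * expR (2 * L * x)) = L * (D * expR (2 * L * x)).
  by field.
by apply: G_lip => // k; exact: H.
Qed.

(** Each solution is its own Picard image, so [picard_halves] can be iterated on the pair: the
    weighted distance is at most [D / 2 ^+ k] for every [k]. *)
Lemma picard_unique (u v : R -> 'I_n -> R) D :
  (forall i, deriv_cc T (u^~ i) (fun s => G s (u s) i)) ->
  (forall i, deriv_cc T (v^~ i) (fun s => G s (v s) i)) ->
  (forall i, u 0 i = v 0 i) -> 0 <= D ->
  (forall s i, 0 <= s <= T -> `|u s i - v s i| <= D) ->
  forall s i, 0 <= s <= T -> u s i = v s i.
Proof.
move=> Hu Hv uv D0 H s i sT.
have Hk k : forall s i, 0 <= s <= T ->
    `|u s i - v s i| <= D / 2 ^+ k * expR (2 * L * s).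
  elim: k => [t j tT|k IH].
    rewrite expr0 divr1 (le_trans (H _ _ tT)) // ler_peMr //.
    by case/andP: tT => t0 _; rewrite -expR0 ler_expR !mulr_ge0 // ltW.
  rewrite exprSr invfM mulrA; apply: picard_halves IH => //.
  by rewrite divr_ge0 // exprn_ge0.
apply/eqP; rewrite -subr_eq0 -normr_le0.
apply: (@le0_of_le_div_exp2 _ (D * expR (2 * L * s))) => k.
by rewrite mulrAC; exact: Hk.
Qed.

Lemma picard_existence (mu : 'I_n -> R) : exists2 u : R -> 'I_n -> R,
  forall i, u 0 i = mu i &
  forall i, deriv_cc T (u^~ i) (fun s => G s (u s) i).
Proof.
(* [choice] needs a total operator: at a discontinuous [u] the value [u] is a dummy, and the
   property is claimed for continuous [u] only. *)
have /choice[Phi HPhi] (u : R -> 'I_n -> R) : exists v : R -> 'I_n -> R,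
    (forall i, cont_cc T (u^~ i)) -> forall i,
    v 0 i = mu i /\ deriv_cc T (v^~ i) (fun s => G s (u s) i).
  have [cu|] := pselect (forall i, cont_cc T (u^~ i)); last first.
    by move=> nc; exists u.
  have /choice[P HP] i : exists P : R -> R,
      P 0 = 0 /\ deriv_cc T P (fun s => G s (u s) i).
    by have [P P0 HP] := cont_cc_antiderivative T0 (cont_cc_field_comp cu i); exists P.
  exists (fun s i => mu i + P i s) => _ i; have [P0 dP] := HP i.
  split; first by rewrite P0 addr0.
  have := deriv_ccD (@deriv_cc_cst _ T (mu i)) dP.
  by congr deriv_cc; apply/funext => s; rewrite add0r.
pose u_ k := iter k Phi (fun=> mu).
have cu k i : cont_cc T ((u_ k)^~ i).
  elim: k i => [|k IH] i; first exact/deriv_cc_cont/deriv_cc_cst.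
  by have [_ /deriv_cc_cont] := HPhi _ IH i.
have u0 k i : u_ k.+1 0 i = mu i by have [] := HPhi _ (cu k) i.
have du k i : deriv_cc T ((u_ k.+1)^~ i) (fun s => G s (u_ k s) i).
  by have [] := HPhi _ (cu k) i.
(* The first Picard step has speed at most [B] over a time at most [T]; the absolute value is taken
   because no sign of [B] is given. *)
have D0 : 0 <= `|B| * T by rewrite mulr_ge0.
have expge1 s : 0 <= s -> 1 <= expR (2 * L * s).
  by move=> s0; rewrite -expR0 ler_expR !mulr_ge0 // ltW.
set D := `|B| * T in D0.
have diff k s i : 0 <= s <= T ->
    `|u_ k.+1 s i - u_ k s i| <= D / 2 ^+ k * expR (2 * L * s).
  elim: k s i => [s i sT|k IH s i].
    rewrite expr0 divr1.
    have := deriv_cc_dist_le (du 0%N i) (@deriv_cc_linear _ T `|B|) sT.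
    rewrite u0 mulr0 subr0 => /(_ _)/le_trans; apply.
      by move=> x xT; rewrite (le_trans (G_bound _ _ xT)) // ler_norm.
    case/andP: sT => s0 sT; rewrite (@le_trans _ _ D) // ?ler_wpM2l //.
    by rewrite ler_peMr // expge1.
  rewrite exprSr invfM mulrA; apply: (picard_halves (du k.+1) (du k)) => //.
    by move=> j; rewrite !u0.
  by rewrite divr_ge0 // exprn_ge0.
have [u Hu] : exists u : R -> 'I_n -> R, forall s i k, 0 <= s <= T ->
    `|u s i - u_ k s i| <= 2 * D / 2 ^+ k * expR (2 * L * s).
  suff /choice [f Hf] : forall si : R * 'I_n, exists l, forall k, 0 <= si.1 <= T ->
      `|l - u_ k si.1 si.2| <= 2 * D / 2 ^+ k * expR (2 * L * si.1).
    by exists (fun s i => f (s, i)) => s i k; exact: (Hf (s, i)).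
  move=> [s i] /=; have [sT|nsT] := pselect (0 <= s <= T); last by exists 0.
  have [|l Hl] := @geometric_cauchy R (fun k => u_ k s i) (D * expR (2 * L * s)).
    by move=> k; rewrite mulrAC diff.
  by exists l => k _; rewrite mulrAC -[2 * D * _]mulrA Hl.
(* A uniform limit of continuous functions: three errors below [e / 3]. *)
have cu' i : cont_cc T (u^~ i).
  move=> s sT e e0; have e3 : 0 < e / 3 by rewrite divr_gt0.
  have [k Hk] := exists_div_exp2_lt (2 * D * expR (2 * L * T)) e3.
  have Hb t : 0 <= t <= T -> `|u t i - u_ k t i| < e / 3.
    move=> tT; apply: le_lt_trans Hk; rewrite mulrAC (le_trans (Hu _ _ k tT)) //.
    rewrite ler_wpM2l ?divr_ge0 ?mulr_ge0 ?exprn_ge0 //.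
    by rewrite ler_expR ler_wpM2l ?mulr_ge0 ?(ltW L0) //; case/andP: tT.
  have [d [d0 Hd]] := cu k i s sT _ e3.
  exists d; split => // t tT td.
  have := Hd t tT td; have := Hb t tT; have := Hb s sT; rewrite distrC.
  have := ler_distD (u_ k t i) (u t i) (u s i).
  have := ler_distD (u_ k s i) (u_ k t i) (u s i).
  lra.
(* One more application of the operator brings differentiability. [u] and [v] agree on [[0, T]], as
   both are limits of the iterates. *)
pose v := Phi u.
have v0 i : v 0 i = mu i by have [] := HPhi _ cu' i.
have dv i : deriv_cc T (v^~ i) (fun s => G s (u s) i) by have [] := HPhi _ cu' i.
have uv s : 0 <= s <= T -> u s = v s.
  move=> sT; apply/funext => i; apply/eqP; rewrite -subr_eq0 -normr_le0.
  apply: (@le0_of_le_div_exp2 _ (2 * D * expR (2 * L * s))) => k.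
  have h1 := Hu s i k.+1 sT.
  have h2 : `|u_ k.+1 s i - v s i| <= 2 * D / 2 ^+ k / 2 * expR (2 * L * s).
    apply: (picard_halves (du k) dv) => // [j||t j tT].
    - by rewrite u0 v0.
    - by rewrite divr_ge0 ?exprn_ge0 // mulr_ge0.
    - by rewrite distrC Hu.
  have := ler_distD (u_ k.+1 s i) (u s i) (v s i).
  have -> : 2 * D * expR (2 * L * s) / 2 ^+ k =
    2 * D / 2 ^+ k.+1 * expR (2 * L * s) + 2 * D / 2 ^+ k / 2 * expR (2 * L * s).
    by rewrite exprSr; field; rewrite expf_neq0.
  lra.
(* The condition at [s] involves the derivative at [s] alone, so rewriting [u s] into [v s] there
   suffices. *)
by exists v => // i s sT e e0; have := dv i s sT e e0; rewrite (uv s sT).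
Qed.

End Picard.

(** * The drift: mass conservation, Lipschitz estimate, lower bound *)

Section Drift.
Variables (R : realType) (n : nat).
Implicit Types (w m : 'M[R]_n) (x y : 'I_n -> R).

Definition drift w m x (i : 'I_n) : R := divG w m i + lapG w x i.

Lemma driftE w m x i : w i i = 0 ->
  drift w m x i = \sum_j (Num.sqrt (w i j) * m j i + w i j * (x j - x i)).
Proof.
move=> wii; rewrite /drift /divG /lapG big_split /= [in RHS](bigD1 i) //=.
by rewrite wii sqrtr0 mul0r add0r.
Qed.

Lemma skewG_entry m i j : skewG m -> m i j = - m j i.
Proof. by move=> /matrixP/(_ j i); rewrite !mxE. Qed.

(** Conservation of mass: exchanging [i] and [j] reverses the sign of every summand, by symmetry of
    [w] and skewness of [m]. *)
Lemma drift_sum0 w m x : weighted_graph w -> skewG m ->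
  \sum_i drift w m x i = 0.
Proof.
move=> [wsym [_ [wd _]]] sm.
under eq_bigr do rewrite driftE //.
set S := LHS; suff : S = - S by lra.
rewrite {1}/S exchange_big /= -sumrN; apply: eq_bigr => i _.
rewrite -sumrN; apply: eq_bigr => j _.
by rewrite (wsym j i) (skewG_entry i j sm); ring.
Qed.

Lemma drift_dist_le w m m' x y i (W D E : R) : w i i = 0 ->
  (forall j, 0 <= w i j <= W) -> (forall j, `|m j i - m' j i| <= E) ->
  (forall k, `|x k - y k| <= D) ->
  `|drift w m x i - drift w m' y i| <= n%:R * (Num.sqrt W * E + W * (2 * D)).
Proof.
move=> wii wW mE xD; rewrite !driftE // -sumrB.
rewrite (le_trans (ler_norm_sum _ _ _)) // mulr_natl -[X in _ <= _ *+ X]card_ord.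
rewrite -sumr_const; apply: ler_sum => j _; case/andP: (wW j) => w0 wj.
have -> : Num.sqrt (w i j) * m j i + w i j * (x j - x i) -
    (Num.sqrt (w i j) * m' j i + w i j * (y j - y i)) =
    Num.sqrt (w i j) * (m j i - m' j i) + w i j * ((x j - y j) - (x i - y i)).
  by ring.
rewrite (le_trans (ler_normD _ _)) // !normrM ger0_norm ?sqrtr_ge0 //.
rewrite (ger0_norm w0); apply: lerD; apply: ler_pM; rewrite ?sqrtr_ge0 //.
  by rewrite ler_wsqrtr.
by rewrite (le_trans (ler_normB _ _)) //; have := xD i; have := xD j; lra.
Qed.

(** Each of the [n] summands of the drift at [i] is at least [- C * x i]. As [r] is chosen before
    [w], [m] and [x], it depends only on [n], [h] and the extreme weights. *)
Lemma drift_ge (h : R -> R) (wmin wmax : R) :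
  (forall u : R, 0 < u -> 0 < h u) ->
  (exists M : R, forall u : R, 0 < u -> h u <= M) ->
  h x @[x --> +oo] --> 0 -> 0 < wmin ->
  exists2 r : R, 0 < r & forall w m x, weighted_graph w ->
    is_omega_min w wmin -> is_omega_max w wmax -> skewG m ->
    (forall k, 0 < x k) ->
    (forall i j, 0 < w i j -> `|m i j| <= (x i + x j) * h (x j / x i)) ->
    forall i, - r * x i <= drift w m x i.
Proof.
move=> h0 [M hM] hoo wmin0.
have sw0 : 0 < Num.sqrt wmin by rewrite sqrtr_gt0.
have [K0 [_ HK0]] : \forall u \near +oo, h u <= Num.sqrt wmin.
  move/cvgrPdist_le: hoo => /(_ _ sw0); apply: filterS => u.
  by rewrite sub0r normrN; apply: le_trans; exact: ler_norm.
pose K := Num.max K0 0.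
have K_ge0 : 0 <= K by rewrite le_max lexx orbT.
have HK u : K < u -> h u <= Num.sqrt wmin.
  by move=> Ku; apply: HK0; apply: le_lt_trans Ku; rewrite le_max lexx.
have M0 : 0 < M by apply: lt_le_trans (h0 1 ltr01) (hM 1 ltr01).
(* Twice [wmax] pays for large ratios, [wmax] plus the last term for small ones. The absolute value
   is taken because no graph has yet fixed the sign of [wmax]. *)
pose C := 2 * `|wmax| + Num.sqrt wmax * (M * (1 + K)).
have C0 : 0 <= C.
  by rewrite addr_ge0 ?mulr_ge0 ?sqrtr_ge0 ?addr_ge0 // ltW.
exists (n%:R * C + 1); first by rewrite ltr_wpDl // mulr_ge0.
move=> w m x [wsym [w0 [wd _]]] [_ Hmin] [_ Hmax] sm x0 Hm i.
rewrite driftE //.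
apply: (@le_trans _ _ (\sum_(j < n) (- (C * x i)))).
  rewrite sumr_const card_ord -mulr_natl; have := x0 i.
  have : 0 <= n%:R :> R by []; lra.
apply: ler_sum => j _.
have xi := x0 i; have xj := x0 j.
have [wp|] := ltP 0 (w i j); last first.
  move=> wn; have -> : w i j = 0 by apply/eqP; rewrite eq_le wn w0.
  by rewrite sqrtr0 !mul0r addr0 oppr_le0 mulr_ge0 // ltW.
set s := Num.sqrt (w i j).
have s0 : 0 <= s by rewrite sqrtr_ge0.
have ss : s * s = w i j by rewrite -expr2 sqr_sqrtr.
have wM := Hmax _ _ wp.
have sM : s <= Num.sqrt wmax by rewrite ler_wsqrtr.
have sm_ : Num.sqrt wmin <= s by rewrite ler_wsqrtr // Hmin.
have wmaxE : `|wmax| = wmax.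
  by rewrite ger0_norm // (le_trans _ wM).
have hp : 0 < h (x j / x i) by rewrite h0 // divr_gt0.
(* Going through [m i j] puts the ratio [x j / x i] inside [h], so that large ratios are those where
   [x j] dominates [x i]. *)
have mji : - ((x i + x j) * h (x j / x i)) <= m j i.
  have := Hm _ _ wp; rewrite (skewG_entry i j sm) normrN.
  by rewrite ler_norml => /andP[].
have [big|small] := ltP K (x j / x i).
  (* As [h <= s], transport loses at most [w i j * (x i + x j)]; the diffusion [w i j * (x j - x i)]
     cancels the [x j] part and leaves [- 2 * w i j * x i]. *)
  have hs : h (x j / x i) <= s by apply: le_trans (HK _ big) sm_.
  have e1 : s * ((x i + x j) * h (x j / x i)) <= (x i + x j) * w i j.
    rewrite -ss mulrCA ler_wpM2l ?addr_ge0 ?(ltW xi) ?(ltW xj) //.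
    by rewrite ler_wpM2l.
  have e2 := ler_wpM2l s0 mji.
  have e3 : w i j * x i <= wmax * x i by rewrite ler_wpM2r // ltW.
  have e4 : 0 <= Num.sqrt wmax * (M * (1 + K)) * x i.
    by rewrite !mulr_ge0 ?sqrtr_ge0 ?addr_ge0 // ltW.
  rewrite /C wmaxE; lra.
(* Here transport is bounded by a multiple of [x i], and the inflow [w i j * x j] enters only
   through its sign. *)
have xjK : x j <= K * x i by rewrite -ler_pdivrMr.
have e1 : s * ((x i + x j) * h (x j / x i)) <= Num.sqrt wmax * (M * (1 + K)) * x i.
  apply: (@le_trans _ _ (Num.sqrt wmax * ((1 + K) * x i * M))); last by lra.
  apply: ler_pM => //; first by rewrite mulr_ge0 ?addr_ge0 // ltW.
  apply: ler_pM; rewrite ?addr_ge0 ?(ltW xi) ?(ltW xj) ?(ltW hp) //; first lra.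
  by rewrite hM // divr_gt0.
have e2 := ler_wpM2l s0 mji.
have e3 : w i j * x i <= wmax * x i by rewrite ler_wpM2r // ltW.
have e4 : 0 <= w i j * x j by rewrite mulr_ge0 // ltW.
have e5 : 0 <= w i j * x i by rewrite mulr_ge0 // ltW.
rewrite /C wmaxE; lra.
Qed.

End Drift.

(** * Regularity of [A] on a compact box inside the open cube *)

Section C1Box.
Variables (R : realType) (n : nat) (T a b : R) (A : R -> ('I_n -> R) -> 'M[R]_n).
Hypotheses (a0 : 0 < a) (b1 : b < 1).
Hypothesis AC1 : C1_dom T A.
Implicit Types (x y : 'I_n -> R).

Let box x := forall k, a <= x k <= b.

Lemma box_in_dom s x : 0 <= s <= T -> box x -> in_dom T s x.
Proof.
move=> sT bx; split => // k; case/andP: (bx k) => ax xb.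
by rewrite (lt_le_trans a0 ax) (le_lt_trans xb b1).
Qed.

(** The partial derivatives in the state are bounded on a compact set, and the box is convex, so the
    mean value inequality on the segment from [y] to [x] gives the constant. *)
Lemma C1_box_lipschitz : exists2 K, 0 <= K & forall s x y i j, 0 <= s <= T ->
  box x -> box y -> `|A s x i j - A s y i j| <= K * \sum_k `|x k - y k|.
Proof.
have [dAs [dAm [dA cA]]] := AC1.
(* Time and state are packed into one row vector, time at index [0], so that compactness of a
   product of intervals applies. *)
pose tl (v : 'rV[R]_n.+1) (k : 'I_n) := v ord0 (lift ord0 k).
pose I_ (i : 'I_n.+1) : set R :=
  if unlift ord0 i is Some _ then [set z | a <= z <= b] else [set z | 0 <= z <= T].
pose Q : set 'rV[R]_n.+1 := [set v | forall i, I_ i (v ord0 i)].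
have QE v : Q v <-> 0 <= v ord0 ord0 <= T /\ box (tl v).
  split=> [Qv|[v0 vb] i].
    split; first by have := Qv ord0; rewrite /I_ unlift_none.
    by move=> k; have := Qv (lift ord0 k); rewrite /I_ liftK.
  rewrite /I_; case: unliftP => [k|] ->; rewrite //; exact: vb.
have cQ : compact Q.
  by apply: rV_compact => i; rewrite /I_; case: unlift => *;
    rewrite -set_itvcc; exact: segment_compact.
pose P (M : R) (v : 'rV[R]_n.+1) := Q v -> forall k i j,
  `|dAm (v ord0 ord0) (tl v) k i j| <= M.
have [M0 [_ HM]] : \forall M \near +oo, Q `<=` P M.
  move/compact_near_coveringP: cQ; apply => v /QE[v0 vb].
  have [d [d0 Hd]] := cA _ _ (box_in_dom v0 vb) 1 ltr01.
  (* Near [v] each partial derivative is within [1] of its value at [v], so every bound above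
     [m + 1] holds locally; compactness makes it uniform. *)
  pose m := \big[Num.max/0]_(p : 'I_n * 'I_n * 'I_n)
    `|dAm (v ord0 ord0) (tl v) p.1.1 p.1.2 p.2|.
  exists (ball v d, [set M | m + 1 < M]).
    by split; [exact: nbhsx_ballx|exists (m + 1); split => //; exact: num_real].
  move=> [v' M] [/= [_ vv'] mM] /QE[v'0 v'b] k i j.
  have [||_ /(_ k) Hk] := Hd _ _ (box_in_dom v'0 v'b) _ _ i j.
  - by rewrite distrC; exact: vv'.
  - by move=> l; rewrite distrC; exact: vv'.
  have : `|dAm (v ord0 ord0) (tl v) k i j| <= m by exact: (le_bigmax _ _ (k, i, j)).
  have := ler_normD (dAm (v' ord0 ord0) (tl v') k i j - dAm (v ord0 ord0) (tl v) k i j)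
    (dAm (v ord0 ord0) (tl v) k i j).
  rewrite subrK; lra.
pose M := Num.max M0 0 + 1.
have M_ge0 : 0 <= M by rewrite addr_ge0 // le_max lexx orbT.
have {}HM s x : 0 <= s <= T -> box x -> forall k i j, `|dAm s x k i j| <= M.
  move=> sT bx.
  pose v : 'rV[R]_n.+1 := \row_i (if unlift ord0 i is Some k then x k else s).
  have vx : tl v = x by apply/funext => k; rewrite /tl mxE liftK.
  have vs : v ord0 ord0 = s by rewrite mxE unlift_none.
  have Qv : Q v by apply/QE; rewrite vx vs.
  have MM : M0 < M by rewrite /M ltr_pwDr // le_max lexx.
  by have := HM M MM v Qv Qv; rewrite vx vs.
exists M => // s x y i j sT bx by_.
pose z t k := y k + t * (x k - y k).
have bz t : 0 <= t <= 1 -> box (z t).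
  move=> /andP[t0 t1] k; rewrite /z; have := bx k; have := by_ k; nra.
pose S := \sum_k `|x k - y k|.
have S0 : 0 <= S by exact: sumr_ge0.
have S1 : 0 < S + 1 by rewrite ltr_wpDl.
have dz : deriv_cc 1 (fun t => A s (z t) i j)
    (fun t => \sum_k (x k - y k) * dAm s (z t) k i j).
  move=> t t1 e e0.
  (* The point moves by [S] times the step in the sum norm; [S + 1] is a safe divisor when
     [x = y]. *)
  have [d [d0 Hd]] := dA _ _ (box_in_dom sT (bz _ t1)) _ (divr_gt0 e0 S1).
  exists (d / (S + 1)); split; first by rewrite divr_gt0.
  move=> t' t'1 tt'; rewrite ltr_pdivlMr // in tt'.
  have zz k : z t' k - z t k = (t' - t) * (x k - y k) by rewrite /z; ring.
  have ss : `|s - s| < d by rewrite subrr normr0.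
  have zd k : `|z t' k - z t k| < d.
    rewrite zz normrM; apply: le_lt_trans tt'.
    rewrite ler_wpM2l // (@le_trans _ _ S) ?lerDl //.
    by rewrite /S (bigD1 k) //= lerDl sumr_ge0.
  have := Hd s _ (box_in_dom sT (bz _ t'1)) ss zd i j.
  rewrite subrr normr0 mul0r subr0 add0r.
  under eq_bigr do rewrite zz -mulrA.
  under [X in _ <= _ * X -> _]eq_bigr do rewrite zz normrM.
  rewrite -!mulr_sumr -/S => /le_trans; apply.
  rewrite mulrAC ler_pdivrMr // -mulrA ler_wpM2l ?(ltW e0) //.
  by rewrite ler_wpM2l // lerDl.
have /= := deriv_cc_dist_le dz (@deriv_cc_linear _ 1 (M * S)) (t := 1).
have -> : z 1 = x by apply/funext => k; rewrite /z; ring.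
have -> : z 0 = y by apply/funext => k; rewrite /z; ring.
rewrite mulr0 subr0 mulr1; apply; first by rewrite ler01 lexx.
move=> t t1; rewrite (le_trans (ler_norm_sum _ _ _)) // mulr_sumr.
apply: ler_sum => k _; rewrite normrM mulrC ler_wpM2r //.
exact: HM (bz _ t1) _ _ _.
Qed.

(** Supplies continuity in time at a frozen state, where all state increments in [C1_dom] vanish. *)
Lemma C1_box_deriv x i j : box x -> exists f', deriv_cc T (fun s => A s x i j) f'.
Proof.
have [dAs [dAm [dA _]]] := AC1 => bx; exists (fun s => dAs s x i j) => s sT e e0.
have [d [d0 Hd]] := dA _ _ (box_in_dom sT bx) _ e0.
exists d; split => // t tT ts.
have xd k : `|x k - x k| < d by rewrite subrr normr0.
have := Hd t x (box_in_dom tT bx) ts xd i j.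
under eq_bigr do rewrite subrr mul0r.
under [X in _ <= _ * (_ + X) -> _]eq_bigr do rewrite subrr normr0.
by rewrite !big1_eq subr0 addr0.
Qed.

End C1Box.

(** * Barrier, mass and speed bounds along trajectories *)

Section Dynamics.
Variables (R : realType) (n : nat) (w : 'M[R]_n) (T r : R).
Variable A : R -> ('I_n -> R) -> 'M[R]_n.
Hypothesis wG : weighted_graph w.
Hypothesis r0 : 0 < r.
Hypothesis A_skew : forall s x, in_dom T s x -> skewG (A s x).
Hypothesis drift_lb : forall s x, in_dom T s x ->
  forall i, - r * x i <= drift w (A s x) x i.
Variables (eps : R) (mu : 'I_n -> R).
Hypotheses (eps0 : 0 < eps) (mu_eps : P_eps eps mu).

Let a := eps * expR (- r * T).

(* Covers the equation itself ([y = u]) and its truncation ([y] the clamp of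
   [u] at level [a]), so truncated solutions never reach the truncation. *)
Lemma trajectory_bounds (u y : R -> 'I_n -> R) :
  (forall i, u 0 i = mu i) ->
  (forall i, deriv_cc T (u^~ i) (fun s => drift w (A s (y s)) (y s) i)) ->
  (forall s, 0 <= s <= T -> in_dom T s (y s)) ->
  (forall s i, 0 <= s <= T -> y s i <= Num.max a (u s i)) ->
  forall s, 0 <= s <= T ->
    (forall i, eps * expR (- r * s) <= u s i) /\ \sum_i u s i = 1.
Proof.
move=> u0 du ydom yu s sT; have [_ [mu1 mu_gt]] := mu_eps; split=> [i|].
  rewrite -subr_ge0.
  have dg := deriv_ccB (du i) (@deriv_cc_expR _ T eps (- r)).
  apply: (deriv_cc_ge0 dg _ _ sT).
    by rewrite u0 mulr0 expR0 mulr1 subr_ge0 ltW.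
  (* Where [u] is below the barrier, so is [y], or at most equal to it, because the barrier is at
     least [a]; then the drift is at least [- r * y t i], hence at least the slope of the
     barrier. *)
  move=> t tT; rewrite subr_lt0 => ut.
  have aE : a <= eps * expR (- r * t).
    rewrite /a ler_wpM2l ?(ltW eps0) // ler_expR.
    by case/andP: tT => _ tT; rewrite ler_wnM2l // oppr_le0 ltW.
  have yE : y t i <= eps * expR (- r * t).
    by rewrite (le_trans (yu t i tT)) // ge_max aE ltW.
  have := drift_lb (ydom t tT) i.
  have := ler_wpM2l (ltW r0) yE; lra.
have := deriv_cc_dist_le (deriv_cc_sum du) (@deriv_cc_cst _ T 0) sT.
under [X in `|_ - X| <= _]eq_bigr do rewrite u0.
rewrite mu1 subrr normr_le0 subr_eq0 => /(_ _)/eqP; apply => t tT.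
by rewrite drift_sum0 ?normr0 //; apply/A_skew/ydom.
Qed.

(** Each component is at least [- r] because [x < 1]; as they sum to zero, the others bound each one
    from above. This is the speed bound for Picard iteration. *)
Lemma drift_norm_le s x i : in_dom T s x -> `|drift w (A s x) x i| <= n%:R * r.
Proof.
move=> sx; have [_ xk] := sx.
have lb j : - r <= drift w (A s x) x j.
  apply: le_trans (drift_lb sx j); case/andP: (xk j) => x0 x1.
  by rewrite mulNr lerN2 ler_piMr // ltW.
have n1 : (1 : R) <= n%:R by rewrite ler1n; case: (n) i => [[]|].
have rn : r <= n%:R * r by rewrite ler_peMl // ltW.
have := drift_sum0 x wG (A_skew sx); rewrite (bigD1 i) //= => sum0.
have : \sum_(j < n | j != i) (- r) <= \sum_(j < n | j != i) drift w (A s x) x j.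
  by apply: ler_sum => j _; exact: lb.
have : - (n%:R * r) <= \sum_(j < n | j != i) (- r).
  rewrite sumr_const mulNrn lerN2 -[r *+ _]mulr_natl.
  by rewrite ler_wpM2r ?(ltW r0) // ler_nat (leq_trans (max_card _)) // card_ord.
have := lb i; rewrite ler_norml; lra.
Qed.

End Dynamics.

Theorem theorem1p1 (R : realType) (n : nat) (h : R -> R)
  (h_pos : forall u : R, 0 < u -> 0 < h u)
  (h_bdd : exists M : R, forall u : R, 0 < u -> h u <= M)
  (h_lim0 : h x @[x --> 0^'+] --> 0)
  (h_limoo : h x @[x --> +oo] --> 0)
  (wmin wmax : R) :
  exists c r : R, 0 < c /\ 0 < r /\
  forall w : 'M[R]_n, weighted_graph w ->
    is_omega_min w wmin -> is_omega_max w wmax ->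
  forall T : R, 0 < T ->
  forall A : R -> ('I_n -> R) -> 'M[R]_n,
    C1_dom T A ->
    (forall s mu, in_dom T s mu -> skewG (A s mu)) ->
    (forall s mu, in_dom T s mu -> forall i j, 0 < w i j ->
        `|A s mu i j| <= (mu i + mu j) * h (mu j / mu i)) ->
  forall eps : R, 0 < eps ->
  forall mu : 'I_n -> R, P_eps eps mu ->
  exists rho : R -> 'I_n -> R,
    ode_sol w A T mu rho /\
    (forall rho2, ode_sol w A T mu rho2 ->
        forall s, 0 <= s <= T -> forall i, rho2 s i = rho s i) /\
    (forall s, 0 <= s <= T -> forall i, c * eps * expR (- r * s) <= rho s i).
Proof.
(* No graph has a minimal edge weight [wmin <= 0], so any constants do in that case. *)
have [wmin0|wmin0] := ltP 0 wmin; last first.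
  exists 1, 1; do 2 split => //; move=> w _ [[i [j [wp wE]]] _].
  by move: wp; rewrite wE ltNge wmin0.
have [r r0 drift_lb] := @drift_ge R n h wmin wmax h_pos h_bdd h_limoo wmin0.
exists 1, r; do 2 split => //; move=> w wG wmn wmx T T0 A AC1 A_skew A_le eps eps0 mu mu_eps.
have T0' := ltW T0.
have lb s x : in_dom T s x -> forall i, - r * x i <= drift w (A s x) x i.
  move=> sx; apply: drift_lb => //; first exact: A_skew.
    by case: sx => _ xk k; case/andP: (xk k).
  by move=> i j; exact: A_le.
have [_ [w0 [wd _]]] := wG.
(* The edge attaining [wmax] provides two distinct vertices. *)
have [[i0 [j0 [wij _]]] wmax_ge] := wmx.
have ij0 : i0 != j0 by apply: contraTneq wij => ->; rewrite wd ltxx.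
have wmax0 : 0 < wmax := lt_le_trans wij (wmax_ge _ _ wij).
have wW i j : 0 <= w i j <= wmax.
  rewrite w0 /=; have [/wmax_ge//|wn] := ltP 0 (w i j).
  by rewrite (le_trans wn) // ltW.
pose a := eps * expR (- r * T).
have a0 : 0 < a by rewrite mulr_gt0 // expR_gt0.
have aE s : 0 <= s <= T -> a <= eps * expR (- r * s).
  move=> /andP[_ sT]; rewrite ler_wpM2l ?(ltW eps0) // ler_expR.
  by rewrite ler_wnM2l // oppr_le0 ltW.
(* With total mass [1] and a second vertex carrying at least [a], no component exceeds [1 - a]. *)
have in_box (x : 'I_n -> R) : (forall i, a <= x i) -> \sum_i x i = 1 ->
    forall i, a <= x i <= 1 - a.
  move=> ax x1 i; rewrite ax /=.
  have [j ji] : exists j, j != i.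
    by have [<-|] := eqVneq i0 i; [exists j0; rewrite eq_sym|exists i0].
  have := x1; rewrite (bigD1 i) //= (bigD1 j) //=.
  have := ax j.
  have : 0 <= \sum_(k < n | (k != i) && (k != j)) x k.
    by apply: sumr_ge0 => k _; apply: le_trans (ax k); exact: ltW.
  lra.
have [mu0 [mu1 mu_gt]] := mu_eps.
have mu_ge_a i : a <= mu i.
  apply: le_trans (ltW (mu_gt i)).
  by have := aE 0; rewrite mulr0 expR0 mulr1 lexx T0'; apply.
have ab : a <= 1 - a by have /andP[] := in_box _ mu_ge_a mu1 i0; exact: le_trans.
have b1 : 1 - a < 1 by rewrite gtrBl.
pose cl (x : 'I_n -> R) k := clamp a (1 - a) (x k).
have cl_box x k : a <= cl x k <= 1 - a by exact: clamp_itv.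
have cl_dom s x : 0 <= s <= T -> in_dom T s (cl x).
  by move=> sT; apply: (box_in_dom a0 b1).
have cl_id x : (forall k, a <= x k <= 1 - a) -> cl x = x.
  by move=> bx; apply/funext => k; exact: clamp_id.
have [K K0 A_lip] := C1_box_lipschitz a0 b1 AC1.
pose G s x := drift w (A s (cl x)) (cl x).
(* [A] is Lipschitz for the sum norm, which costs a factor [n] against a componentwise bound; the
   [+ 1] gives positivity at once. *)
pose L := n%:R * (Num.sqrt wmax * (K * n%:R) + wmax * 2) + 1.
have L0 : 0 < L.
  by rewrite ltr_wpDl // mulr_ge0 // addr_ge0 // !mulr_ge0 ?sqrtr_ge0 // ltW.
have G_lip s x y D : 0 <= s <= T -> (forall k, `|x k - y k| <= D) ->
    forall i, `|G s x i - G s y i| <= L * D.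
  move=> sT xy i.
  have D0 : 0 <= D by apply: le_trans (xy i0).
  have clD k : `|cl x k - cl y k| <= D by apply: le_trans (xy k); exact: clamp_dist.
  have AD j : `|A s (cl x) j i - A s (cl y) j i| <= K * (n%:R * D).
    rewrite (le_trans (A_lip _ _ _ _ _ sT (cl_box x) (cl_box y))) // ler_wpM2l //.
    rewrite mulr_natl -[X in _ <= _ *+ X]card_ord -sumr_const.
    by apply: ler_sum.
  apply: le_trans (drift_dist_le (wd i) (wW i) AD clD) _.
  rewrite /L; lra.
have G_cont x i : cont_cc T (fun s => G s x i).
  have /choice[f' Hf'] (j : 'I_n) := C1_box_deriv a0 b1 AC1 j i (cl_box x).
  rewrite /G; under [X in cont_cc _ X]eq_fun do rewrite driftE //.
  apply: deriv_cc_cont; apply: deriv_cc_sum => j; apply: deriv_ccD.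
    by apply: deriv_ccZ; exact: Hf'.
  exact: deriv_cc_cst.
have G_bound s x i : 0 <= s <= T -> `|G s x i| <= n%:R * r.
  by move=> sT; apply: (drift_norm_le wG r0 A_skew lb); exact: cl_dom.
have [u u0 du] := picard_existence T0' L0 G_lip G_cont G_bound mu.
have bounds := trajectory_bounds wG r0 A_skew lb eps0 mu_eps.
(* Clamping raises a value only up to [a], as [trajectory_bounds] asks of [y]. *)
have ub s (sT : 0 <= s <= T) := bounds u (fun s => cl (u s)) u0 du
  (fun s => cl_dom s (u s)) (fun s i _ => clamp_le_max a (1 - a) (u s i)) s sT.
have u_box s : 0 <= s <= T -> forall i, a <= u s i <= 1 - a.
  move=> sT; have [ul us] := ub s sT.
  by apply: in_box => // i; apply: le_trans (ul i); exact: aE.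
exists u; split; [|split].
- split => //; split.
    by move=> s sT i; have [_] := box_in_dom a0 b1 sT (u_box s sT).
  exists (fun s => G s (u s)); split=> [i|s sT i].
    split; first exact: du.
    apply: (cont_cc_field_comp L0 G_lip G_cont) => j; exact: deriv_cc_cont (du j).
  by rewrite /G cl_id //; exact: u_box.
- move=> v [v0 [v01 [v' [dv v'E]]]].
  have vdom s : 0 <= s <= T -> in_dom T s (v s) by move=> sT; split => //; exact: v01.
  have dv1 i : deriv_cc T (v^~ i) (fun s => drift w (A s (v s)) (v s) i).
    by move=> s sT; rewrite -[drift _ _ _ _]v'E //; exact: (dv i).1.
  have vb s (sT : 0 <= s <= T) : (forall i, eps * expR (- r * s) <= v s i) /\
      \sum_i v s i = 1.
    apply: (bounds v v) => // t i tT; by rewrite le_max lexx orbT.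
  have v_box s : 0 <= s <= T -> forall i, a <= v s i <= 1 - a.
    move=> sT; have [vl vs] := vb s sT.
    by apply: in_box => // i; apply: le_trans (vl i); exact: aE.
  (* Truncation is the identity on the box, so [v] solves the truncated equation too. *)
  have dv2 i : deriv_cc T (v^~ i) (fun s => G s (v s) i).
    by move=> s sT; rewrite /G cl_id; [exact: dv1|exact: v_box].
  move=> s sT i.
  (* Both solutions lie in a box of side less than [1], so [1] bounds their distance. *)
  apply: (picard_unique L0 G_lip dv2 du _ ler01) => // [j|t j tT].
    by rewrite v0 u0.
  have := v_box t tT j; have := u_box t tT j; rewrite ler_norml; lra.
- by move=> s sT i; rewrite mul1r; exact: (ub s sT).1.
Qed.
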